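(* Let $b>1$ be a positive integer and let $\mathcal{A}$ be a finite set of integers that does not contain $0$. Then for every sequence $\{a_n\}_{n=1}^\infty$ with $a_n\in\mathcal{A}$ for all $n$, the real number \[ \sum_{n=1}^\infty d(n)\frac{a_n}{b^n} \] is irrational.
   Context: $d(n)$ denotes the number of positive divisors of the positive integer $n$. *)

(* Defs.v *)
From mathcomp Require Export all_boot all_order all_algebra.
From mathcomp Require Export all_classical all_reals all_analysis.

Set Implicit Arguments.
Unset Strict Implicit.
Unset Printing Implicit Defensive.

Import Order.TTheory GRing.Theory Num.Theory.
Import numFieldNormedType.Exports.
Local Open Scope classical_set_scope.
Local Open Scope ring_scope.

Definition num_divisors (n : nat) : nat := size (divisors n).

(* The N-th term is the sum over 1 <= n < N; the value a 0 is never used. *)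
Definition divisor_series (R : realType) (b : nat) (a : nat -> int) : R^nat :=
  fun N => \sum_(1 <= n < N)
    ((num_divisors n)%:R * ((a n)%:~R / b%:R ^+ n)).

(* Main.v *)
Require Import Defs.
From mathcomp Require Import zify ring lra.
Import Order.TTheory GRing.Theory Num.Theory.
Import numFieldNormedType.Exports.

(** Following Erdős, suppose the sum is [l] with denominator [q].  The idea is to
    find a block of [K] consecutive integers [m, ..., m + K - 1] whose divisor
    counts are all divisible by [b ^ K].  Multiplying [l] by [q * b ^ m], every
    term up to [n = m + K - 1] becomes an integer, hence so is
    [q * b ^ m] times the remaining tail.  If that tail is nonzero and smaller
    than [1 / (q * b ^ m)], this is a contradiction.

    The block is produced by the Chinese remainder theorem, prescribing
    [p ^ (b - 1)] as the exact power of [p] in [m + j] for [K = 3 h] primes [p]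
    for each [j < K].  To make the tail nonzero whatever the coefficients are,
    [h] further primes are spent on its first term, so that
    [b ^ h] divides [d (m + K)]; then this term dominates all the following ones
    but is still much smaller than [b ^ K].  Both facts come from averaging
    over [m = c + M t], [t < 2 M], in the residue class modulo the
    product [M] of the [p ^ b]: the average of [d (c + i + M t)] is
    [O (d (gcd (c + i, M)) (log M + i))], where [log M] is polynomial in [h].
    The gcd is [1] for [K < i] below the size of the primes, and beyond that
    [b ^ - i] absorbs [d (M)]. *)

Local Open Scope nat_scope.

(** * Elementary properties of the divisor function *)

Lemma num_divisors_gt0 n : 0 < num_divisors n.
Proof. by have := divisor1 n; rewrite /num_divisors; case: divisors. Qed.

Lemma num_divisorsE n y : 0 < n -> n <= y ->
  num_divisors n = count (dvdn^~ n) (index_iota 1 y.+1).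
Proof.
move=> n0 ny; rewrite -size_filter; apply/perm_size/uniq_perm.
- exact: divisors_uniq.
- by rewrite filter_uniq ?iota_uniq.
move=> e; rewrite -dvdn_divisors // mem_filter mem_index_iota.
case: (boolP (e %| n)) => //= en.
by rewrite (dvdn_gt0 n0 en) /= ltnS (leq_trans (dvdn_leq n0 en)).
Qed.

Lemma num_divisors_le n : 0 < n -> num_divisors n <= n.
Proof.
move=> n0; rewrite (num_divisorsE _ n) // (leq_trans (count_size _ _)) //.
by rewrite size_iota subn1.
Qed.

Lemma num_divisors_dvd m n : 0 < n -> m %| n -> num_divisors m <= num_divisors n.
Proof.
move=> n0 mn; apply: uniq_leq_size; first exact: divisors_uniq.
move=> e; rewrite -dvdn_divisors ?(dvdn_gt0 n0 mn) // -dvdn_divisors // => em.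
exact: dvdn_trans em mn.
Qed.

Lemma num_divisorsM m n : coprime m n ->
  num_divisors (m * n) = num_divisors m * num_divisors n.
Proof.
have [->|m0] := posnP m; first by rewrite /coprime gcd0n => /eqP ->.
have [->|n0] := posnP n; first by rewrite /coprime gcdn0 => /eqP ->.
move=> mn; rewrite /num_divisors -(size_allpairs muln).
apply/perm_size/uniq_perm; first exact: divisors_uniq.
  apply: allpairs_uniq; rewrite ?divisors_uniq // => -[x y] [z w].
  move=> /allpairsP[[x' y'] /= [xm yn [-> ->]]].
  move=> /allpairsP[[z' w'] /= [zm wn [-> ->]]] /= e.
  move: xm yn zm wn; rewrite -!dvdn_divisors // => xm yn zm wn.
  have co a b' : a %| m -> b' %| n -> coprime a b'.
    by move=> am bn; apply: coprime_dvdl am (coprime_dvdr bn mn).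
  have ex : x' = z'.
    apply/eqP; rewrite eqn_dvd -(Gauss_dvdl z' (co _ _ xm wn)) -e dvdn_mulr //=.
    by rewrite -(Gauss_dvdl x' (co _ _ zm yn)) e dvdn_mulr.
  move: e; rewrite ex => /eqP; rewrite eqn_pmul2l ?(dvdn_gt0 m0 zm) // => /eqP ->.
  by [].
move=> e; rewrite -dvdn_divisors ?muln_gt0 ?m0 //; apply/idP/allpairsP => /=.
  move=> emn; exists (gcdn e m, gcdn e n) => /=.
  rewrite -!dvdn_divisors // !dvdn_gcdr; split=> //.
  apply/eqP; rewrite eqn_dvd Gauss_dvd ?dvdn_gcdl ?andbT; last first.
    exact: coprime_dvdl (dvdn_gcdr _ _) (coprime_dvdr (dvdn_gcdr _ _) mn).
  by rewrite muln_gcdl !muln_gcdr !dvdn_gcd emn !(dvdn_mulr _ (dvdnn e)) dvdn_mull.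
move=> [[x y] /= []]; rewrite -!dvdn_divisors // => xm yn ->.
exact: dvdn_mul.
Qed.

Lemma num_divisors_pexp p k : prime p -> num_divisors (p ^ k) = k.+1.
Proof.
move=> p_pr; suff -> : num_divisors (p ^ k) = size [seq p ^ i | i <- iota 0 k.+1].
  by rewrite size_map size_iota.
apply/perm_size/uniq_perm; first exact: divisors_uniq.
  rewrite map_inj_in_uniq ?iota_uniq // => i j _ _ /eqP.
  by rewrite eqn_exp2l ?prime_gt1 // => /eqP.
move=> e; rewrite -dvdn_divisors ?expn_gt0 ?prime_gt0 //.
apply/dvdn_pfactor/mapP => // -[i].
  by move=> ik ->; exists i; rewrite // mem_iota add0n ltnS.
by rewrite mem_iota add0n ltnS /= => ik ->; exists i.
Qed.

(* Divisors above the square root pair off with those below it. *)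
Lemma num_divisors_le2 n y : 0 < n -> n <= y * y ->
  num_divisors n <= 2 * count (dvdn^~ n) (index_iota 1 y.+1).
Proof.
move=> n0 ny; rewrite mul2n -addnn.
set s := [seq e <- index_iota 1 y.+1 | e %| n].
have -> : count (dvdn^~ n) (index_iota 1 y.+1) = size s by rewrite size_filter.
have : size (divisors n) <= size (s ++ [seq n %/ e | e <- s]).
  apply: uniq_leq_size; first exact: divisors_uniq.
  move=> e; rewrite -dvdn_divisors // => en; rewrite mem_cat.
  have e0 := dvdn_gt0 n0 en.
  have [ey|ye] := leqP e y.
    by rewrite mem_filter en mem_index_iota e0 ltnS ey.
  apply/orP; right; apply/mapP; exists (n %/ e).
    rewrite mem_filter dvdn_div //= mem_index_iota ltnS divn_gt0 // dvdn_leq //=.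
    rewrite -(leq_pmul2r e0) divnK // (leq_trans ny) // leq_mul2l ltnW ?orbT //.
  by rewrite divnA // mulKn.
by rewrite size_cat size_map.
Qed.

(** * Averages of the divisor function along an arithmetic progression *)

Lemma sum_nat_of_bool (r : seq nat) (P : pred nat) :
  \sum_(i <- r) (P i : nat) = count P r.
Proof.
by rewrite -sum1_count [RHS]big_mkcond; apply: eq_bigr => i _; case: (P i).
Qed.

(** All elements of [A] lie in one class modulo [f], so they are told apart by their quotients by
    [f], of which at most [(T %/ f).+1] occur. *)
Lemma count_congruent (A : pred nat) f T : 0 < f ->
  (forall t u, A t -> A u -> t <= u -> f %| u - t) ->
  count A (iota 0 T) <= (T %/ f).+1.
Proof.
move=> f0 Af; rewrite -size_filter -(size_map (divn^~ f)) -(size_iota 0 (T %/ f).+1).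
apply: uniq_leq_size.
  rewrite map_inj_in_uniq ?filter_uniq ?iota_uniq // => t u.
  rewrite !mem_filter => /andP[At _] /andP[Au _] tu.
  wlog le_tu : t u At Au tu / t <= u.
    move=> H; have [|/ltnW] := leqP t u; first exact: H.
    by move=> ut; apply/esym/H.
  have := Af _ _ At Au le_tu; rewrite -eqn_mod_dvd // => /eqP mtu.
  by rewrite (divn_eq t f) (divn_eq u f) tu mtu.
move=> x /mapP[t]; rewrite mem_filter !mem_iota /= !add0n => /andP[_ tT] ->.
by rewrite ltnS leq_div2r // ltnW.
Qed.

(** The congruence [c + M * t = 0] modulo [e] is solvable only if [gcdn e M] divides [c], and it
    then determines [t] modulo [e %/ gcdn e M]. *)
Lemma count_dvd_progression c M T e : 0 < e ->
  \sum_(0 <= t < T) (e %| c + M * t : nat) <=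
  (gcdn e M %| c) * (T %/ (e %/ gcdn e M)).+1.
Proof.
move=> e0; set g := gcdn e M.
have g0 : 0 < g by rewrite gcdn_gt0 e0.
have [gc|gc] := boolP (g %| c); last first.
  rewrite mul0n leqn0 big1 // => t _; apply/eqP; rewrite eqb0.
  apply: contra gc => /(dvdn_trans (dvdn_gcdl e M)).
  by rewrite -/g dvdn_addl // dvdn_mulr // dvdn_gcdr.
rewrite mul1n sum_nat_of_bool /index_iota subn0; apply: count_congruent.
  by rewrite divn_gt0 // dvdn_leq // dvdn_gcdl.
move=> t u et eu tu.
have : e %| M * (u - t).
  have := dvdn_sub eu et; rewrite subnDl -mulnBr //.
have cop : coprime (e %/ g) (M %/ g).
  rewrite /coprime -(eqn_pmul2r g0) mul1n muln_gcdl !divnK ?dvdn_gcdl ?dvdn_gcdr //.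
have eE : e = e %/ g * g by rewrite divnK // dvdn_gcdl.
have ME : M = M %/ g * g by rewrite divnK // dvdn_gcdr.
by rewrite {1}eE {1}ME mulnAC dvdn_pmul2r // Gauss_dvdr.
Qed.

(** Each dyadic range of [f] contributes at most [T]; this is the logarithm in the average. *)
Lemma sum_div_dyadic T k : \sum_(1 <= f < 2 ^ k) T %/ f <= T * k.
Proof.
elim: k => [|k IH]; first by rewrite big_geq.
rewrite (big_cat_nat (n := 2 ^ k)) ?expn_gt0 ?leq_exp2l //= mulnS addnC.
apply: leq_add => //.
apply: (@leq_trans (\sum_(2 ^ k <= f < 2 ^ k.+1) T %/ 2 ^ k)).
  rewrite big_nat [leqRHS]big_nat; apply: leq_sum => f /andP[kf _].
  by apply: leq_div2l => //; rewrite expn_gt0.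
by rewrite sum_nat_const_nat expnS mul2n -addnn addnK mulnC leq_divM.
Qed.

(** After exchanging the sums, write [e = g * f] with [g = gcdn e M]. Only those [g] that divide
    [gcdn c M] contribute, each with at most a harmonic sum over [f]. *)
Lemma sum_dvd_progression c M T y k : 0 < M -> y < 2 ^ k ->
  \sum_(0 <= t < T) \sum_(1 <= e < y.+1) (e %| c + M * t : nat) <=
  num_divisors (gcdn c M) * (T * k + y).
Proof.
move=> M0 yk; rewrite exchange_big /=.
have cM0 : 0 < gcdn c M by rewrite gcdn_gt0 M0 orbT.
apply: (@leq_trans (\sum_(1 <= e < y.+1) \sum_(g <- divisors (gcdn c M))
   \sum_(1 <= f < y.+1) (e == g * f) * (T %/ f).+1)).
  rewrite big_nat [leqRHS]big_nat; apply: leq_sum => e /andP[e0 ey].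
  apply: leq_trans (count_dvd_progression c M T e e0) _.
  set g := gcdn e M.
  have g0 : 0 < g by rewrite gcdn_gt0 e0.
  have [gc|gc] := boolP (g %| c); last by rewrite mul0n.
  rewrite (bigD1_seq g) ?divisors_uniq //=; last first.
    by rewrite -dvdn_divisors // dvdn_gcd gc dvdn_gcdr.
  apply: leq_trans (leq_addr _ _).
  rewrite (bigD1_seq (e %/ g)) ?iota_uniq //=; last first.
    rewrite mem_index_iota divn_gt0 // dvdn_leq ?dvdn_gcdl //=.
    exact: leq_ltn_trans (leq_div _ _) ey.
  by apply: leq_trans (leq_addr _ _); rewrite [g * _]mulnC divnK ?dvdn_gcdl ?eqxx.
rewrite exchange_big /= /num_divisors -sum1_size big_distrl /=.
rewrite big_seq [leqRHS]big_seq; apply: leq_sum => g.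
rewrite -dvdn_divisors // => gd; have g0 := dvdn_gt0 cM0 gd.
rewrite mul1n exchange_big /=.
apply: (@leq_trans (\sum_(1 <= f < y.+1) (T %/ f).+1)).
  apply: leq_sum => f _; rewrite -big_distrl /= -[leqRHS]mul1n leq_mul2r.
  rewrite sum_nat_of_bool (eq_count (a2 := pred1 (g * f))) //.
  by rewrite count_uniq_mem ?iota_uniq // leq_b1 orbT.
rewrite (eq_bigr (fun f => T %/ f + 1)); last by move=> f _; rewrite addn1.
rewrite big_split /= sum_nat_const_nat subn1 muln1 leq_add2r.
apply: leq_trans (sum_div_dyadic T k).
by rewrite [leqRHS](big_cat_nat (n := y.+1)) //= leq_addr.
Qed.

(** * A supply of large primes with an explicit upper bound *)

Lemma logn_le_exp2 p n k : 0 < n -> n <= 2 ^ k -> logn p n <= k.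
Proof.
move=> n0 nk; have [p_pr|np] := boolP (prime p); last by rewrite lognE (negbTE np).
rewrite -(@leq_exp2l 2) //; apply: leq_trans nk.
apply: leq_trans (dvdn_leq n0 (pfactor_dvdnn p n)).
by have [->|l0] := posnP (logn p n); rewrite // leq_exp2r // prime_gt1.
Qed.

(* An integer up to [2 ^ t] is determined by its exponents at the primes up to
   [2 ^ t], each of which is at most [t]. *)
Lemma exp2_le_prime_count t :
  2 ^ t <= t.+1 ^ count prime (iota 0 (2 ^ t).+1).
Proof.
set ps := [seq p <- iota 0 (2 ^ t).+1 | prime p].
rewrite -size_filter -/ps.
pose f (n : 'I_(2 ^ t)) : (size ps).-tuple 'I_t.+1 :=
  [tuple inord (logn (nth 0 ps i) n.+1) | i < size ps].
have f_inj : injective f.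
  move=> m n /(congr1 (fun u => tnth u)) fmn; apply/val_inj/succn_inj.
  apply: eqn_from_log => // p.
  have [pP|] := boolP (p \in ps).
    have lt_i : index p ps < size ps by rewrite index_mem.
    have := congr1 (fun g => val (g (Ordinal lt_i))) fmn.
    by rewrite /= !tnth_mktuple /= nth_index // !inordK // ltnS logn_le_exp2.
  rewrite mem_filter negb_and => /orP[np|].
    have l0 n0 : logn p n0 = 0 by rewrite lognE (negbTE np).
    by rewrite !l0.
  rewrite mem_iota add0n ltnS -ltnNge => lt_p.
  have lt_log (j : 'I_(2 ^ t)) : logn p j.+1 = 0.
    by rewrite lognE (gtnNdvd _ (leq_ltn_trans (ltn_ord j) lt_p)) // !andbF.
  by rewrite !lt_log.
by have := leq_card f f_inj; rewrite card_ord card_tuple card_ord.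
Qed.

Lemma exists_primes P N : 5 <= P + N ->
  exists s : seq nat, [/\ uniq s, size s = N &
    forall p, p \in s -> [/\ prime p, P < p & p <= 2 ^ ((P + N) * (P + N))]].
Proof.
set X := P + N => X5; set t := X * X.
have lt_count : X < count prime (iota 0 (2 ^ t).+1).
  rewrite ltnNge; apply/negP => le_count.
  have := exp2_le_prime_count t; rewrite leqNgt => /negP; apply.
  apply: (@leq_ltn_trans (t.+1 ^ X)); first by rewrite leq_pexp2l.
  (* Comparing [X]-th powers leaves [X * X + 1 < 2 ^ X], which holds from [X = 5] on. *)
  rewrite /t expnM ltn_exp2r; last by apply: leq_trans X5.
  rewrite -(subnKC X5); elim: (X - 5) => // d IHd.
  by rewrite addnS expnS; nia.
pose s := [seq p <- iota 0 (2 ^ t).+1 | prime p & P < p].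
have size_s : N <= size s.
  have : count prime (iota 0 (2 ^ t).+1) <= P.+1 + size s.
    rewrite -size_filter -(size_iota 0 P.+1) -size_cat; apply: uniq_leq_size.
      by rewrite filter_uniq ?iota_uniq.
    move=> p; rewrite mem_cat !mem_filter !mem_iota !add0n /= ltnS.
    by case/andP=> -> ->; case: leqP.
  rewrite /X in lt_count; lia.
exists (take N s); split.
- by rewrite take_uniq // filter_uniq ?iota_uniq.
- by rewrite size_takel.
move=> p /mem_take; rewrite mem_filter mem_iota add0n ltnS /=.
by case/andP=> /andP[-> ->] ->.
Qed.

(** * Chinese remaindering and divisor counts from prescribed exponents *)

Lemma coprime_prodr_seq (I : eqType) (r : seq I) (F : I -> nat) m :
  (forall i, i \in r -> coprime m (F i)) -> coprime m (\prod_(i <- r) F i).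
Proof.
elim: r => [|i r IH] mF; first by rewrite big_nil coprimen1.
rewrite big_cons coprimeMr mF ?mem_head // IH // => j jr.
by apply: mF; rewrite inE jr orbT.
Qed.

Lemma chinese_remainder_seq (s : seq nat) (F r : nat -> nat) : uniq s ->
  {in s &, forall p q, p != q -> coprime (F p) (F q)} ->
  exists c, forall p, p \in s -> c = r p %[mod F p].
Proof.
elim: s => [|p s IH] /=; first by exists 0.
case/andP=> ps us co; have [|c cP] := IH us.
  by move=> x y xs ys; apply: co; rewrite inE ?xs ?ys orbT.
have copi : coprime (F p) (\prod_(q <- s) F q).
  apply: coprime_prodr_seq => q qs; apply: co; rewrite ?mem_head ?inE ?qs ?orbT //.
  by apply: contraNneq ps => ->.
exists (chinese (F p) (\prod_(q <- s) F q) (r p) c) => q.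
rewrite inE => /predU1P[->|qs]; first by rewrite chinese_modl.
rewrite -cP //; apply/eqP.
have := chinese_modr copi (r p) c => /eqP.
have dv : F q %| \prod_(q <- s) F q by rewrite (big_rem q) //= dvdn_mulr.
move=> /eqP e.
by rewrite -(modn_dvdm _ dv) e modn_dvdm.
Qed.

Lemma num_divisors_prod_pexp (s : seq nat) k : uniq s -> all prime s ->
  num_divisors (\prod_(p <- s) p ^ k) = k.+1 ^ size s.
Proof.
elim: s => [|p s IH] /=; first by rewrite big_nil.
case/andP=> ps us /andP[p_pr s_pr]; rewrite big_cons num_divisorsM.
  by rewrite num_divisors_pexp // IH // expnS.
apply: coprime_prodr_seq => q qs; apply/coprimeXl/coprimeXr.
rewrite prime_coprime // dvdn_prime2 //; last exact: (allP s_pr).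
by apply: contraNneq ps => ->.
Qed.

(** By multiplicativity, each prime of exact exponent [b.-1] contributes a factor [b] to the divisor
    count. *)
Lemma exp_dvd_num_divisors (s : seq nat) b n : 0 < b -> 0 < n ->
  uniq s -> all prime s -> {in s, forall p, logn p n = b.-1} ->
  b ^ size s %| num_divisors n.
Proof.
move=> b0; elim: s n => [|p s IH] n n0 /=; first by rewrite dvd1n.
case/andP=> ps us /andP[p_pr s_pr] ln.
have [m pm en] := pfactor_coprime p_pr n0.
rewrite en mulnC num_divisorsM; last exact: coprimeXl.
rewrite num_divisors_pexp // ln ?mem_head // prednK // expnS dvdn_pmul2l //.
have m0 : 0 < m by move: n0; rewrite en muln_gt0 => /andP[].
apply: IH => // q qs; rewrite -(ln q) ?inE ?qs ?orbT // {1}en.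
rewrite (lognM q m0) ?expn_gt0 ?(prime_gt0 p_pr) // lognX (logn_prime q p_pr).
by rewrite (_ : (q == p) = false) ?muln0 ?addn0 //; apply: contraNF ps => /eqP <-.
Qed.

(** * Geometric weights and the choice of a good term by averaging *)

Lemma sum_linear_geometric b P J : 1 < b ->
  \sum_(P <= i < P + J) i * b ^ (P + J - i) + 2 * (P + J).+1 <= 2 * P.+1 * b ^ J.
Proof.
(* The summand [2 * (P + J).+1] on the left is the slack that lets the induction close, as soon as
   [b >= 2]. *)
move=> b1; elim: J => [|J IH]; first by rewrite addn0 big_geq // muln1 add0n.
rewrite addnS big_nat_recr ?leq_addr //= subSnn expn1.
have -> : \sum_(P <= i < P + J) i * b ^ ((P + J).+1 - i) =
  b * \sum_(P <= i < P + J) i * b ^ (P + J - i).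
  rewrite big_distrr /= big_nat [RHS]big_nat; apply: eq_bigr => i /andP[_ iP].
  by rewrite (subSn (ltnW iP)) expnS mulnCA.
move: IH; set S := \sum_(_ <= _ < _) _; rewrite expnS; nia.
Qed.

Lemma exp2_gt_pow C : exists h, 0 < h /\ C * h ^ 6 < 2 ^ h.
Proof.
(* With [h] a power of two only exponents are compared: [C + 6 * u <= 7 * u < 2 ^ u]. *)
pose u := C + 6; exists (2 ^ u); split; first by rewrite expn_gt0.
apply: (@leq_ltn_trans (2 ^ (C + u * 6))).
  by rewrite -expnM expnD leq_mul2r ltnW ?orbT // ltn_expl.
rewrite ltn_exp2l // (@leq_ltn_trans (7 * u)) //; first by rewrite /u; lia.
by rewrite /u; elim: C {u} => // n; rewrite addSn expnS; lia.
Qed.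

Lemma average_num_divisors c M T y k : 0 < c -> 0 < M ->
    c + M * T <= y * y -> y < 2 ^ k ->
  \sum_(0 <= t < T) num_divisors (c + M * t) <=
  2 * (num_divisors (gcdn c M) * (T * k + y)).
Proof.
move=> c0 M0 cy yk.
apply: leq_trans (leq_mul (leqnn 2) (sum_dvd_progression c M T y k M0 yk)).
rewrite big_distrr /= big_nat [leqRHS]big_nat; apply: leq_sum => t /andP[_ tT].
rewrite sum_nat_of_bool; apply: num_divisors_le2; first by rewrite addn_gt0 c0.
by apply: leq_trans cy; rewrite leq_add2l leq_mul2l ltnW ?orbT.
Qed.

(** An average bound alone yields a good [t] depending on [I]. Since an excess at [I] persists at
    all later indices, if every [t < T] failed somewhere, all would fail together at the largest of
    these indices, against the average there. *)
Lemma uniform_average T (f : nat -> nat -> nat) (B : nat -> nat) : 0 < T ->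
    (forall I, \sum_(0 <= t < T) f t I <= T * B I) ->
    (forall t I, B I < f t I -> B I.+1 < f t I.+1) ->
  exists t, forall I, f t I <= B I.
Proof.
move=> T0 avg up; apply: contrapT => /forallNP nex.
have bad t : exists I, B I < f t I.
  apply: contrapT => /forallNP H; apply: (nex t) => I.
  by rewrite leqNgt; apply/negP/H.
have up_le t I J : I <= J -> B I < f t I -> B J < f t J.
  by move=> /subnK <- bI; elim: (J - I) => // d; rewrite addSn; apply: up.
have [I badI] : exists I, forall t, t < T -> B I < f t I.
  elim: T {T0 avg} => [|T [I IH]]; first by exists 0.
  have [J bJ] := bad T; exists (maxn I J) => t.
  rewrite ltnS leq_eqVlt => /predU1P[->|tT].
    exact: up_le (leq_maxr _ _) bJ.
  exact: up_le (leq_maxl _ _) (IH t tT).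
have := avg I; rewrite leqNgt => /negP; apply.
apply: (@leq_trans (T * (B I).+1)); first by rewrite ltn_pmul2l.
rewrite -[T in T * _]subn0 -sum_nat_const_nat big_nat [leqRHS]big_nat.
by apply: leq_sum => t /andP[_ tT]; apply: badI.
Qed.

(** Split at [P]. Below it [D i <= 1] and the sum costs [2 * b ^ I]; from [P] on, the decay by
    [b ^ P] outweighs both [b ^ Q] and the factor [P.+1], which again costs [2 * b ^ I]. *)
Lemma weighted_geometric_sum b P Q (D : nat -> nat) I : 1 < b -> Q <= P ->
    P.+1 <= b ^ (P - Q) -> (forall i, 0 < i < P -> D i <= 1) ->
    (forall i, D i <= b ^ Q) ->
  \sum_(1 <= i < I) D i * (i * b ^ (I - i)) <= 4 * b ^ I.
Proof.
move=> b1 QP Pb D1 DQ; have b0 : 0 < b by apply: ltnW.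
apply: (@leq_trans (\sum_(0 <= i < I) (i * b ^ (I - i)
                    + (P <= i) * (b ^ Q * (i * b ^ (I - i)))))).
  have [I0|I0] := posnP I; first by rewrite I0 !big_geq.
  rewrite [leqRHS]big_ltn // (leq_trans _ (leq_addl _ _)) //.
  rewrite big_nat [leqRHS]big_nat; apply: leq_sum => i /andP[i0 iI].
  have [Pi|iP] := leqP P i.
    by rewrite mul1n (leq_trans _ (leq_addl _ _)) // leq_mul2r DQ orbT.
  rewrite mul0n addn0 -[leqRHS]mul1n leq_mul2r D1 ?orbT //.
  by rewrite i0.
rewrite big_split /= (_ : 4 = 2 + 2) // mulnDl leq_add //.
  by have := sum_linear_geometric b 0 I b1; rewrite !add0n; lia.
have [PI|/ltnW IP] := leqP P I; last first.
  rewrite big_nat big1 // => i /andP[_ iI].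
  by rewrite leqNgt (leq_trans iI IP).
rewrite (big_cat_nat (n := P)) //= [X in X + _]big_nat big1 ?add0n; last first.
  by move=> i /andP[_ iP]; rewrite leqNgt iP.
apply: (@leq_trans (b ^ Q * (2 * P.+1 * b ^ (I - P)))).
  rewrite (eq_big_nat _ _ (F2 := fun i => b ^ Q * (i * b ^ (I - i)))); last first.
    by move=> i /andP[-> _]; rewrite mul1n.
  rewrite -big_distrr /= leq_mul2l; apply/orP; right.
  have := sum_linear_geometric b P (I - P) b1; rewrite subnKC //; lia.
rewrite mulnCA -!mulnA leq_mul2l /=.
apply: (@leq_trans (b ^ (P - Q) * (b ^ Q * b ^ (I - P)))).
  by rewrite leq_mul2r Pb orbT.
by rewrite -!expnD addnA subnK // subnKC.
Qed.

Lemma exists_small_tail b M n0 k P Q B0 : 1 < b -> 0 < M -> 0 < n0 ->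
    n0 <= 2 * M -> 2 * M <= 2 ^ k -> Q <= P -> P.+1 <= b ^ (P - Q) ->
    num_divisors (gcdn n0 M) <= B0 ->
    (forall i, 0 < i < P -> coprime (n0 + i) M) -> num_divisors M <= b ^ Q ->
  exists t, num_divisors (n0 + M * t) <= 10 * (k + 4) * B0 /\
    forall I, \sum_(1 <= i < I) num_divisors (n0 + M * t + i) * b ^ (I - i) <=
              10 * (k + 4) * b ^ I.
Proof.
move=> b1 M0 n00 n0M Mk QP Pb DB0 Dcop DM; have b0 : 0 < b by apply: ltnW.
(* For [t < T] the values [n0 + M * t + i] have square root at most [T + i], so the error term of
   the average is comparable to its main term. *)
set L := k + 4; set T := 2 * M.
have B00 : 0 < B0 by apply: leq_trans DB0; apply: num_divisors_gt0.
pose D i := num_divisors (gcdn (n0 + i) M).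
have T0 : 0 < T by rewrite muln_gt0.
have avg i : \sum_(0 <= t < T) num_divisors (n0 + M * t + i) <=
    2 * (D i * (T * (k + 2 * i + 2))).
  under eq_bigr do rewrite addnAC.
  apply: leq_trans (average_num_divisors (n0 + i) M T (T + i) (k + i.+1) _ M0 _ _) _.
  - by rewrite addn_gt0 n00.
  - by rewrite /T in T0 *; nia.
  - have : i < 2 ^ i by apply: ltn_expl.
    by move: Mk; rewrite /T expnD expnS; nia.
  by rewrite leq_mul2l leq_mul2l; apply/orP; right; apply/orP; right; nia.
pose F t I := \sum_(1 <= i < I) num_divisors (n0 + M * t + i) * b ^ (I - i).
(* One quantity carries both bounds: [I = 0] gives the first term, and dropping the second summand
   gives the tail. The weight [b ^ I] makes an excess persist. *)
pose f t I := B0 * F t I + b ^ I * num_divisors (n0 + M * t).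
(* The constant 10 is 8 from the tail plus 2 from the first term. *)
have [] := uniform_average T f (fun I => 10 * L * B0 * b ^ I) T0.
- move=> I; rewrite /f big_split /= -!big_distrr /=.
  have G_le : \sum_(0 <= t < T) num_divisors (n0 + M * t) <= 2 * (B0 * (T * L)).
    have := avg 0; under eq_bigr do rewrite addn0.
    move=> /leq_trans; apply; rewrite leq_mul2l /= leq_mul //.
      by rewrite /D addn0.
    by rewrite leq_mul2l /L; apply/orP; right; lia.
  have F_le : \sum_(0 <= t < T) F t I <= 2 * (T * L) * (4 * b ^ I).
    rewrite exchange_big /=.
    apply: (@leq_trans (\sum_(1 <= i < I) 2 * (T * L) * (D i * (i * b ^ (I - i))))).
      rewrite big_nat [leqRHS]big_nat; apply: leq_sum => i /andP[i0 iI].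
      rewrite -big_distrl /=; apply: (leq_trans (leq_mul (avg i) (leqnn _))).
      have e : 2 * (T * L) * (D i * (i * b ^ (I - i))) =
        2 * (D i * (T * (L * i))) * b ^ (I - i) by lia.
      rewrite e leq_mul2r; apply/orP; right.
      by do 3!(rewrite leq_mul2l; apply/orP; right); rewrite /L; nia.
    rewrite -big_distrr /= leq_mul2l; apply/orP; right.
    apply: (@weighted_geometric_sum b P Q) => //.
      by move=> i /Dcop /eqP; rewrite /D => ->.
    move=> i; apply: leq_trans DM; apply: num_divisors_dvd => //.
    exact: dvdn_gcdr.
  apply: leq_trans (leq_add (leq_mul (leqnn _) F_le) (leq_mul (leqnn _) G_le)) _.
  by rewrite /L; lia.
- move=> t I; rewrite /f => bI.
  have : b * F t I <= F t I.+1.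
    rewrite /F; have [->|I0] := posnP I; first by rewrite big_geq // muln0.
    rewrite [leqRHS]big_nat_recr //= (leq_trans _ (leq_addr _ _)) //.
    rewrite big_distrr /= big_nat [leqRHS]big_nat; apply: leq_sum => i /andP[_ iI].
    by rewrite (subSn (ltnW iI)) expnS mulnCA.
  move: bI; rewrite !expnS; set g := num_divisors _; set a1 := F t I.
  set a2 := F t I.+1; set x := b ^ I => bI /(leq_mul (leqnn B0)) H.
  have : b * (10 * L * B0 * x) < b * (B0 * a1 + x * g) by rewrite ltn_pmul2l.
  lia.
move=> t tP; exists t; split.
  have := tP 0; rewrite /f /F big_geq // muln0 add0n !expn0 mul1n muln1.
  by [].
move=> I; have := tP I; rewrite /f -/(F t I) => H.
rewrite -(leq_pmul2l B00); apply: (leq_trans (leq_trans (leq_addr _ _) H)).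
by rewrite -mulnA mulnCA -mulnA.
Qed.

(** * Construction of the block *)

Lemma logn_eq_pred_of_mod p b n : prime p -> 0 < b ->
  n = p ^ b.-1 %[mod p ^ b] -> 0 < n /\ logn p n = b.-1.
Proof.
move=> p_pr b0 np; have p1 := prime_gt1 p_pr.
have np' : n %% p ^ b = p ^ b.-1.
  by rewrite np modn_small // ltn_exp2l // prednK.
have n0 : 0 < n.
  case: n np' {np} => //; rewrite mod0n => /esym/eqP.
  by rewrite expn_eq0 eqn0Ngt prime_gt0.
split=> //; apply/eqP; rewrite eqn_leq -ltnS prednK // ltnNge.
rewrite -!pfactor_dvdn // /dvdn np' expn_eq0 eqn0Ngt prime_gt0 //=.
rewrite -(@modn_dvdm (p ^ b)) ?np' ?modnn //.
by rewrite dvdn_exp2l // leq_pred.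
Qed.

Lemma prod_le_exp (s : seq nat) (F : nat -> nat) B :
  {in s, forall p, F p <= B} -> \prod_(p <- s) F p <= B ^ size s.
Proof.
elim: s => [|p s IH] sB; first by rewrite big_nil.
rewrite big_cons expnS leq_mul ?sB ?mem_head // IH // => q qs.
by apply: sB; rewrite inE qs orbT.
Qed.

Lemma exists_divisor_block b C : 1 < b -> exists m K,
  [/\ forall j, j < K -> b ^ K %| num_divisors (m + j),
      forall I, C * \sum_(1 <= i < I) num_divisors (m + K + i) * b ^ (I - i) <=
                num_divisors (m + K) * b ^ I &
      C * num_divisors (m + K) < b ^ K].
Proof.
move=> b1; have b0 : 0 < b by apply: ltnW.
(* The constant is fitted to [10 * (k + 4) * C] below, where [k = X * X * b * N + 1],
   [X <= 60 * h ^ 2] and [N <= 10 * h ^ 2]. *)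
have [h [h0 hC]] := exp2_gt_pow (C * (10 * (60 * 60 * 10 * b + 5))).
(* [w] is the block length and [N] the number of primes. [P = 4 * N] leaves a decay of [b ^ (2 * N)]
   after absorbing [num_divisors M <= b ^ (2 * N)]. *)
pose w := 3 * h; pose N := w * w + h; pose P := 4 * N.
have w0 : 0 < w by rewrite muln_gt0.
have N10 : 10 <= N by rewrite /N /w; nia.
have [|s [us ss sP]] := exists_primes (P + w) N; first by rewrite /P; lia.
set X := P + w + N in sP.
have s_pr p : p \in s -> prime p by case/sP.
have all_pr : all prime s by apply/allP.
(* [s] is cut into runs of [w] primes, the last one having only [h]; the primes
   of run number [pos p] are used at offset [pos p]. *)
pose M := \prod_(p <- s) p ^ b; pose pos p := index p s %/ w.
have dvdM p : p \in s -> p ^ b %| M.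
  by move=> ps; rewrite /M (big_rem p) //= dvdn_mulr.
have M0 : 0 < M.
  by rewrite /M big_seq prodn_cond_gt0 // => p /s_pr /prime_gt0 p0; rewrite expn_gt0 p0.
(* The residue is [p ^ b.-1 - pos p] modulo [p ^ b], written without subtraction. *)
have [|c0 c0P] := @chinese_remainder_seq s (fun p => p ^ b)
    (fun p => p ^ b.-1 + (p ^ b).-1 * pos p) us.
  move=> p q ps qs pq; apply/coprimeXl/coprimeXr.
  by rewrite prime_coprime ?s_pr // dvdn_prime2 ?s_pr.
pose c := c0 %% M.
have cP t p : p \in s -> c + M * t + pos p = p ^ b.-1 %[mod p ^ b].
  move=> ps; have [k Mk] := dvdnP (dvdM p ps).
  rewrite -addnA addnCA addnA Mk mulnAC -addnA modnMDl -modnDml /c.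
  rewrite modn_dvdm ?dvdM // c0P // modnDml -addnA -mulSnr prednK; last first.
    by rewrite expn_gt0 prime_gt0 ?s_pr.
  by rewrite addnC mulnC modnMDl.
have log_pos t p : p \in s ->
    0 < c + M * t + pos p /\ logn p (c + M * t + pos p) = b.-1.
  by move=> ps; apply: logn_eq_pred_of_mod; rewrite ?s_pr ?cP.
have block t j v : j * w + v <= N -> v <= w ->
    b ^ v %| num_divisors (c + M * t + j).
  move=> jvN vw; have [->|v0] := posnP v; first by rewrite dvd1n.
  pose r := [seq nth 0 s (j * w + i) | i <- iota 0 v].
  have lt_ss i : i < v -> j * w + i < size s.
    by move=> iv; rewrite ss; apply: leq_trans jvN; rewrite ltn_add2l.
  have rs p : p \in r -> p \in s /\ pos p = j.
    move=> /mapP[i]; rewrite mem_iota add0n /= => iv ->; split.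
      by rewrite mem_nth ?lt_ss.
    rewrite /pos index_uniq ?lt_ss // divnMDl // divn_small ?addn0 //.
    exact: leq_trans iv vw.
  have r0 : nth 0 s (j * w) \in r.
    by apply/mapP; exists 0; rewrite ?addn0 // mem_iota.
  rewrite -[X in b ^ X](size_iota 0) -(size_map (fun i => nth 0 s (j * w + i))) -/r.
  apply: exp_dvd_num_divisors => //.
  - by have [r0s <-] := rs _ r0; have [] := log_pos t _ r0s.
  - rewrite map_inj_in_uniq ?iota_uniq // => i i'.
    rewrite !mem_iota !add0n /= => iv iv' /eqP.
    by rewrite nth_uniq ?lt_ss // eqn_add2l => /eqP.
  - by apply/allP => p /rs[/s_pr].
  by move=> p /rs[ps <-]; have [] := log_pos t p ps.
(* A prime dividing both [c + j] and [c + pos p] would divide [j - pos p], which is positive and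
   less than [p]. *)
have cop p j : p \in s -> pos p < j -> j < p -> coprime (c + j) (p ^ b).
  move=> ps pj jp; apply: coprimeXr; rewrite coprime_sym prime_coprime ?s_pr //.
  apply/negP => pd; have [_] := log_pos 0 p ps.
  rewrite muln0 addn0 => lp.
  have pp : p %| c + pos p.
    have [+ _] := log_pos 0 p ps; rewrite muln0 addn0 => cp0.
    by rewrite -{1}[p]expn1 (pfactor_dvdn _ (s_pr p ps) cp0) lp; lia.
  have := dvdn_sub pd pp; rewrite subnDl.
  by rewrite gtnNdvd ?subn_gt0 // (leq_ltn_trans (leq_subr _ _) jp).
have posw p : p \in s -> pos p <= w.
  move=> ps; rewrite /pos -ltnS ltn_divLR //.
  have := ps; rewrite -index_mem ss => /leq_trans; apply.
  by rewrite /N mulSn addnC leq_add2r /w; lia.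
have Pp p : p \in s -> P + w < p by case/sP.
pose k := X * X * b * N + 1.
have Mk : 2 * M <= 2 ^ k.
  rewrite /k addn1 expnS leq_mul2l /= -ss [2 ^ _]expnM; apply: prod_le_exp => p ps.
  by rewrite [2 ^ _]expnM leq_exp2r //; case: (sP p ps).
have divM : num_divisors M <= b ^ (2 * N).
  rewrite num_divisors_prod_pexp // ss expnM leq_exp2r; last by lia.
  by rewrite -mulnn; nia.
(* The first [w * w] primes have [pos p < w], so only the last [h] can divide [c + w]; then
   [b.+1 <= b ^ 2]. *)
have gcd0 : num_divisors (gcdn (c + w) M) <= b ^ (2 * h).
  pose s1 := take (w * w) s; pose s2 := drop (w * w) s.
  have sE : s = s1 ++ s2 by rewrite cat_take_drop.
  have -> : M = (\prod_(p <- s1) p ^ b) * (\prod_(p <- s2) p ^ b).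
    by rewrite /M {1}sE big_cat.
  rewrite Gauss_gcdr; last first.
    apply: coprime_prodr_seq => p ps1.
    have ps : p \in s by rewrite sE mem_cat ps1.
    apply: cop => //; last by apply: leq_ltn_trans (Pp p ps); rewrite leq_addl.
    rewrite /pos ltn_divLR // sE index_cat ps1.
    have := ps1; rewrite -index_mem => /leq_trans; apply.
    by rewrite size_take; case: ltnP.
  apply: (@leq_trans (num_divisors (\prod_(p <- s2) p ^ b))).
    apply: num_divisors_dvd (dvdn_gcdr _ _).
    rewrite big_seq prodn_cond_gt0 // => p ps2; rewrite expn_gt0 prime_gt0 ?s_pr //.
    by rewrite sE mem_cat ps2 orbT.
  rewrite num_divisors_prod_pexp ?drop_uniq //; last first.
    by apply/allP => p ps2; rewrite s_pr // sE mem_cat ps2 orbT.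
  rewrite size_drop ss /N addKn expnM leq_exp2r //.
  by rewrite -mulnn; nia.
have [] := @exists_small_tail b M (c + w) k P (2 * N) (b ^ (2 * h)) b1 M0 _ _ Mk
             _ _ gcd0 _ divM.
- by rewrite addn_gt0 w0 orbT.
- have ps : nth 0 s 0 \in s by rewrite mem_nth // ss; lia.
  have wM : w <= M.
    have := dvdn_leq M0 (dvdM _ ps); apply: leq_trans.
    apply: leq_trans (_ : nth 0 s 0 ^ 1 <= _); last by rewrite leq_pexp2l // prime_gt0 // s_pr.
    by rewrite expn1; apply: leq_trans (ltnW (Pp _ ps)); rewrite leq_addl.
  by rewrite mul2n -addnn leq_add // ltnW // ltn_pmod.
- by rewrite /P; lia.
- rewrite /P (_ : 4 * N - 2 * N = 2 * N); last by lia.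
  apply: (@leq_trans (2 ^ (2 * N))); last by rewrite leq_exp2r //; lia.
  have : N < 2 ^ N by apply: ltn_expl.
  by rewrite mul2n -addnn expnD; nia.
- move=> i /andP[i0 iP]; rewrite -addnA; apply: coprime_prodr_seq => p ps.
  apply: cop => //; first by have := posw p ps; lia.
  by have := Pp p ps; lia.
move=> t [Gle Fle]; exists (c + M * t), w.
(* This serves twice: [b ^ h] divides the first divisor count, which thus beats the tail; and that
   count is at most [10 * (k + 4) * b ^ (2 * h)], hence small against [b ^ w = b ^ (3 * h)]. *)
have LC : 10 * (k + 4) * C < b ^ h.
  apply: leq_trans (_ : 2 ^ h <= _); last by rewrite leq_exp2r.
  apply: leq_ltn_trans hC.
  have Xh : X <= 60 * h ^ 2.
    by rewrite /X /P /N /w -mulnn; nia.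
  have Nh : N <= 10 * h ^ 2 by rewrite /N /w -mulnn; nia.
  have H : X * X * b * N <= 60 * 60 * 10 * b * h ^ 6.
    have := leq_mul (leq_mul (leq_mul Xh Xh) (leqnn b)) Nh.
    move=> /leq_trans; apply; rewrite (_ : 6 = 2 + 2 + 2) // !expnD.
    by move: (h ^ 2) => z; lia.
  have h6 : 1 <= h ^ 6 by rewrite expn_gt0 h0.
  move: H h6; rewrite /k; move: (X * X * b * N) (h ^ 6) => x y xy y1.
  by rewrite mulnC -mulnA leq_mul2l; apply/orP; right; lia.
have nE : c + M * t + w = c + w + M * t by rewrite addnAC.
split=> [j jw|I|].
- apply: block => //; rewrite /N -mulSnr.
  by apply: leq_trans (leq_addr _ _); rewrite leq_mul2r jw orbT.
- rewrite nE; apply: (leq_trans (leq_mul (leqnn C) (Fle I))).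
  rewrite mulnA leq_mul2r mulnC (leq_trans (ltnW LC)) ?orbT // -nE.
  apply: dvdn_leq; first exact: num_divisors_gt0.
  by apply: block; rewrite /w; lia.
rewrite nE; apply: (leq_ltn_trans (leq_mul (leqnn C) Gle)).
rewrite mulnA [C * _]mulnC (_ : w = h + 2 * h); last by rewrite /w; lia.
by rewrite expnD ltn_pmul2r // expn_gt0 b0.
Qed.

(** * The real series: convergence, integrality, tail bounds and irrationality *)

Local Open Scope classical_set_scope.
Local Open Scope ring_scope.

Lemma finite_int_bound (A : set int) : finite_set A ->
  exists2 B : nat, (0 < B)%N & forall z, A z -> (`|z| <= B)%N.
Proof.
move=> /finite_seqP[s ->]; exists (\max_(z <- s) `|z|)%N.+1 => // z /= zs.
by apply: leqW; exact: (@leq_bigmax_seq _ s xpredT absz z zs isT).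
Qed.

Lemma sum_natr_div_exp (R : realType) (b : nat) (N I : nat) (F : nat -> nat) :
  (0 < b)%N ->
  \sum_(N <= i < I) (F i)%:R / b%:R ^+ i =
  (\sum_(N <= i < I) F i * b ^ (I - i))%N%:R / b%:R ^+ I :> R.
Proof.
move=> b0; have bU k : b%:R ^+ k != 0 :> R by rewrite expf_neq0 // pnatr_eq0 -lt0n.
rewrite natr_sum big_distrl /= big_nat [RHS]big_nat.
apply: eq_bigr => i /andP[_ /ltnW iI].
rewrite natrM natrX -mulrA; congr (_ * _).
by apply: (mulIf (bU I)); rewrite divfK // -{1}(subnK iI) exprD mulrCA mulVf // mulr1.
Qed.

Lemma divisor_series_cvg (R : realType) (b : nat) (a : nat -> int) (B : nat) :
  (1 < b)%N -> (forall n, (1 <= n)%N -> (`|a n| <= B)%N) ->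
  cvgn (divisor_series R b a).
Proof.
move=> b1 aB.
have b0 : 0 < b%:R :> R by rewrite ltr0n ltnW.
pose v (n : nat) : R := if n is 0 then 0
  else (num_divisors n)%:R * ((a n)%:~R / b%:R ^+ n).
have -> : divisor_series R b a = series v.
  apply/funext => N; rewrite /divisor_series /series /=.
  have [->|N0] := posnP N; first by rewrite !big_geq.
  rewrite [RHS]big_ltn // add0r big_nat [RHS]big_nat.
  by apply: eq_bigr => -[|n].
apply: normed_cvg; apply: nondecreasing_is_cvgn.
  move=> m n mn; rewrite -subr_ge0 sub_series_geq //.
  by apply: sumr_ge0 => i _; exact: normr_ge0.
exists (B%:R * 2) => _ [N _ <-]; rewrite /= /series.
apply: (@le_trans _ _ (\sum_(0 <= n < N) B%:R * (n%:R / b%:R ^+ n))).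
  apply: ler_sum => -[|n] _; first by rewrite normr0 mul0r mulr0.
  rewrite /v !normrM mulrCA; apply: ler_pM => //.
  - by rewrite -intr_norm -[_ B]/((Posz B)%:~R) ler_int; have := aB n.+1 isT; lia.
  rewrite normr_nat normfV gtr0_norm ?exprn_gt0 //.
  by rewrite ler_wpM2r ?invr_ge0 ?exprn_ge0 ?(ltW b0) // ler_nat num_divisors_le.
rewrite -big_distrr /= ler_wpM2l ?ler0n // sum_natr_div_exp 1?ltnW //.
rewrite ler_pdivrMr ?exprn_gt0 // -natrX -natrM ler_nat.
by have := sum_linear_geometric b 0 N b1; rewrite !add0n; lia.
Qed.

(** The factor [b ^ m] clears the denominators up to [n = m]; beyond, [b ^ K] in the divisor count
    clears the remaining [b ^ (n - m)]. *)
Lemma divisor_block_int (R : realType) (b m K : nat) (a : nat -> int) :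
  (0 < b)%N -> (forall j, (j < K)%N -> (b ^ K %| num_divisors (m + j))%N) ->
  b%:R ^+ m * divisor_series R b a (m + K) \is a Num.int.
Proof.
move=> b0 blk; have bU k : b%:R ^+ k != 0 :> R by rewrite expf_neq0 // pnatr_eq0 -lt0n.
rewrite /divisor_series big_distrr /= big_nat rpred_sum // => n /andP[_ nmK].
rewrite mulrCA [b%:R ^+ m * _]mulrCA mulrCA rpredM ?intr_int //.
have [nm|mn] := leqP n m.
  rewrite -{1}(subnKC nm) exprD mulrAC divff // mul1r.
  by rewrite rpredM ?natr_int // rpredX // natr_int.
have jK : (n - m < K)%N by lia.
have := blk _ jK; rewrite (subnKC (ltnW mn)) => /dvdnP[e ->].
rewrite -{1}(subnKC (ltnW mn)) exprD invfM mulVKf //.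
rewrite -{1}(subnK (ltnW jK)) expnD !natrM !natrX -!mulrA divff // mulr1.
by rewrite rpredM ?rpredX ?natr_int.
Qed.

(** Here [m] is the first index after the block. Its term has size between [G] and [B * G], because
    [a m] is a nonzero integer, and the later terms add up to at most [G / 4]. *)
Lemma divisor_tail_bounds (R : realType) (b m B C I : nat) (a : nat -> int) :
  (0 < b)%N -> (0 < m)%N -> (0 < I)%N -> (4 * B <= C)%N -> (0 < C)%N ->
  (forall n, (1 <= n)%N -> (0 < `|a n| <= B)%N) ->
  (C * \sum_(1 <= i < I) num_divisors (m + i) * b ^ (I - i) <=
   num_divisors m * b ^ I)%N ->
  (num_divisors m)%:R / 2 <=
    `|b%:R ^+ m * (divisor_series R b a (m + I) - divisor_series R b a m)| <=
  2 * B%:R * (num_divisors m)%:R.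
Proof.
move=> b0 m0 I0 BC C0 aB tail; set x := `|_ * _|.
have b0R : 0 < b%:R :> R by rewrite ltr0n.
have bU k : b%:R ^+ k != 0 :> R by rewrite expf_neq0 // gt_eqF.
have aR n : (1 <= n)%N -> 1 <= `|(a n)%:~R : R| <= B%:R.
  move=> n1; rewrite -intr_norm -[_ B]/((Posz B)%:~R) -[1]/((1 : int)%:~R) !ler_int.
  by have := aB n n1; lia.
set G : R := (num_divisors m)%:R; have G0 : 0 < G by rewrite ltr0n num_divisors_gt0.
pose E : R := \sum_(1 <= i < I) (num_divisors (m + i))%:R *
                ((a (m + i))%:~R / b%:R ^+ i).
have shift (F : nat -> R) :
    \sum_(m <= n < m + I) F n = \sum_(0 <= i < I) F (m + i)%N.
  rewrite -{1}[m]add0n big_addn addKn.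
  by apply: eq_bigr => i _; rewrite addnC.
have xE : x = `|G * (a m)%:~R + E|.
  rewrite /x /divisor_series (big_cat_nat (n := m) (p := m + I)) ?leq_addr //=.
  rewrite [X in _ * X]addrC addKr; congr `|_|.
  rewrite shift big_distrr /= big_ltn // addn0; congr (_ + _).
    by rewrite mulrCA [_ ^+ _ * _]mulrCA divff // mulr1.
  apply: eq_bigr => i _; rewrite exprD invfM mulrCA; congr (_ * _).
  by rewrite mulrCA mulVKf.
have El : `|E| <= G / 4.
  apply: (le_trans (ler_norm_sum _ _ _)).
  apply: (@le_trans _ _ (B%:R * \sum_(1 <= i < I) (num_divisors (m + i))%:R / b%:R ^+ i)).
    rewrite big_distrr /=; apply: ler_sum => i _.
    rewrite !normrM normr_nat normfV (gtr0_norm (exprn_gt0 _ b0R)) mulrCA.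
    rewrite ler_wpM2r ?mulr_ge0 ?invr_ge0 ?exprn_ge0 ?ler0n //.
    by have /andP[] : 1 <= `|(a (m + i))%:~R : R| <= B%:R by apply: aR; rewrite addn_gt0 m0.
  rewrite sum_natr_div_exp // mulrA ler_pdivrMr ?exprn_gt0 //.
  rewrite mulrAC ler_pdivlMr //.
  move: tail; set S := (\sum_(_ <= _ < _) _)%N => tail.
  by rewrite /G -natrX -!natrM ler_nat; nia.
have /andP[a1 a2] := aR m m0.
rewrite xE; apply/andP; split.
  have H : `|G * (a m)%:~R| <= `|G * (a m)%:~R + E| + `|E|.
    by rewrite -{1}[G * _](addrK E) (le_trans (ler_normD _ _)) // normrN.
  have : G <= `|G * (a m)%:~R| by rewrite normrM (gtr0_norm G0) ler_peMr // ltW.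
  lra.
apply: (le_trans (ler_normD _ _)); rewrite normrM (gtr0_norm G0).
have B1 : 1 <= B%:R :> R by apply: le_trans a1 a2.
have : G * `|(a m)%:~R| <= G * B%:R by rewrite ler_wpM2l // ltW.
nra.
Qed.

Theorem theorem2 (R : realType) (b : nat) (hb : (1 < b)%N)
  (A : set int) (finA : finite_set A) (A0 : ~ A 0)
  (a : nat -> int) (aA : forall n : nat, (1 <= n)%N -> A (a n)) :
  cvgn (divisor_series R b a) /\ irrational (limn (divisor_series R b a)).
Proof.
have [B B0 AB] := finite_int_bound A finA.
have b0 : (0 < b)%N := ltnW hb.
have aB n : (1 <= n)%N -> (0 < `|a n| <= B)%N.
  move=> /aA an; rewrite AB // andbT absz_gt0; apply/eqP => a0.
  by apply: A0; rewrite -a0.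
have cv : cvgn (divisor_series R b a).
  by apply: (@divisor_series_cvg _ _ _ B) => // n /aB /andP[].
split=> // -[r _ rl].
pose q := `|denq r|%N; have q0 : (0 < q)%N by rewrite absz_gt0 denq_neq0.
(* The factor [4 * B] makes the first term dominate, and [q] makes the tail too small for the
   denominator. *)
have [m [K [blk tail small]]] := exists_divisor_block b (4 * q * B) hb.
set l := limn _ in rl; set S := divisor_series R b a (m + K).
have b0R : 0 < b%:R :> R by rewrite ltr0n.
have K0 : (0 < K)%N.
  case: K small {blk tail S} => //; rewrite expn0 ltnS leqn0 !muln_eq0.
  by rewrite !eqn0Ngt num_divisors_gt0 q0 B0.
have mK0 : (0 < m + K)%N by rewrite addn_gt0 K0 orbT.
have /intrP[z zE] : q%:R * (b%:R ^+ m * (l - S)) \is a Num.int.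
  rewrite mulrBr mulrBr rpredB //; last first.
    by rewrite rpredM ?natr_int // divisor_block_int.
  rewrite mulrCA rpredM ?rpredX ?natr_int // -rl.
  have -> : q%:R = (denq r)%:~R :> R.
    by rewrite -[RHS](ger0_norm _) ?ler0z ?denq_ge0 // -intr_norm -abszE.
  by rewrite /ratr mulrC divfK ?intr_int // intr_eq0 denq_neq0.
pose x N : R := `|b%:R ^+ (m + K) * (divisor_series R b a N - S)|.
have xcv : x @ \oo --> `|b%:R ^+ (m + K) * (l - S)|.
  apply: cvg_norm; apply: cvgM; first exact: cvg_cst.
  by apply: cvgB; [exact: cv | exact: cvg_cst].
have xlim := cvg_lim (@Rhausdorff R) xcv.
have xbounds N : (m + K < N)%N ->
    (num_divisors (m + K))%:R / 2 <= x N <= 2 * B%:R * (num_divisors (m + K))%:R.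
  move=> mKN; rewrite -(subnKC (ltnW mKN)).
  apply: (@divisor_tail_bounds R b (m + K) B (4 * q * B)) => //.
  - by rewrite subn_gt0.
  - by rewrite -mulnA leq_mul2l /= leq_pmull.
  - by rewrite !muln_gt0 q0.
have xge : (num_divisors (m + K))%:R / 2 <= `|b%:R ^+ (m + K) * (l - S)|.
  rewrite -xlim; apply: limr_ge; first by apply/cvg_ex; eexists; exact: xcv.
  by exists (m + K).+1 => // N /= /xbounds /andP[].
have xle : `|b%:R ^+ (m + K) * (l - S)| <= 2 * B%:R * (num_divisors (m + K))%:R.
  rewrite -xlim; apply: limr_le; first by apply/cvg_ex; eexists; exact: xcv.
  by exists (m + K).+1 => // N /= /xbounds /andP[].
(* The bounds are scaled by [b ^ (m + K)], the integer [z] only by [b ^ m]. The upper bound thus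
   gives [|z| < 1], while the lower one excludes [z = 0]. *)
have xz : q%:R * `|b%:R ^+ (m + K) * (l - S)| = b%:R ^+ K * `|z|%:~R.
  rewrite -[in LHS](normr_nat R q) -normrM intr_norm -zE.
  rewrite -[b%:R ^+ K in RHS](gtr0_norm (exprn_gt0 K b0R)) -normrM.
  by congr `|_|; rewrite exprD; ring.
have q0R : 0 < q%:R :> R by rewrite ltr0n.
have : b%:R ^+ K * `|z|%:~R < b%:R ^+ K :> R.
  rewrite -xz; apply: (le_lt_trans (ler_wpM2l (ltW q0R) xle)).
  rewrite -natrX -!natrM ltr_nat; apply: leq_ltn_trans small; nia.
rewrite -[ltRHS]mulr1 ltr_pM2l ?exprn_gt0 // -[1]/((1 : int)%:~R) ltr_int => z1.
have z0 : z = 0 by lia.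
move: xz xge; rewrite z0 normr0 mulr0 => /eqP; rewrite mulf_eq0 gt_eqF //= => /eqP ->.
by rewrite leNgt divr_gt0 // ltr0n num_divisors_gt0.
Qed.
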